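(* Let $R$ be a commutative semihereditary ring and let $Q$ be its total quotient ring. Then the following conditions are equivalent: (1) $R$ is $\pi$-coherent; (2) $Q$ is self injective (i.e. injective as a $Q$-module). Moreover, when these conditions are satisfied, each singly projective $R$-module is finitely projective.
   Context: A commutative ring is semihereditary if each of its finitely generated ideals is projective. The total quotient ring of $R$ is the localization of $R$ at the set of its non-zero-divisors. A commutative ring $R$ is $\pi$-coherent if, for each index set $\Lambda$, every finitely generated submodule of $R^{\Lambda}$ is finitely presented. An $R$-module $M$ is finitely projective (respectively singly projective) if, for any finitely generated (respectively cyclic) submodule $N$ of $M$, the inclusion map $N\to M$ factors through a free module. *)

(* Defs.v *)
From HB Require Import structures.
From mathcomp Require Import all_boot all_algebra.
From mathcomp Require Import generic_quotient ring boolp classical_sets functions.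

Set Implicit Arguments.
Unset Strict Implicit.
Unset Printing Implicit Defensive.

Import GRing.Theory.
Local Open Scope ring_scope.
Local Open Scope quotient_scope.
Local Open Scope classical_set_scope.

(* Rings are commutative and unital; the zero ring is allowed, hence         *)
(* comPzRingType.  A submodule of M is any N : subLmodType S with            *)
(* S : pred M, and its inclusion map is val : N -> M.                        *)

Section Modules.
Variable R : comPzRingType.
Implicit Types M N P E F : lmodType R.

Definition lin_span M n (x : 'I_n -> M) : set M :=
  [set y | exists c : 'I_n -> R, y = \sum_(i < n) c i *: x i].

Definition finitely_generated M : Prop :=
  exists n (x : 'I_n -> M), lin_span x = setT.

Definition cyclic_module M : Prop :=
  exists x : M, forall y, exists c : R, y = c *: x.

Definition finitely_presented M : Prop :=
  exists n (g : {linear 'rV[R]_n -> M}),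
    (forall y, exists v, g v = y) /\
    exists m (r : 'I_m -> 'rV[R]_n), lin_span r = [set v | g v = 0].

Definition is_basis F (I : choiceType) (b : I -> F) : Prop :=
  (forall (s : seq I) (c : I -> R), uniq s ->
     \sum_(i <- s) c i *: b i = 0 -> forall i, i \in s -> c i = 0) /\
  (forall x, exists (s : seq I) (c : I -> R), x = \sum_(i <- s) c i *: b i).

Definition free_module F : Prop :=
  exists (I : choiceType) (b : I -> F), is_basis b.

Definition projective_module P : Prop :=
  forall M N (p : {linear M -> N}) (f : {linear P -> N}),
    (forall y, exists x, p x = y) ->
    exists h : {linear P -> M}, forall x, p (h x) = f x.

Definition injective_module E : Prop :=
  forall M N (j : {linear M -> N}) (f : {linear M -> E}),
    injective j ->
    exists h : {linear N -> E}, forall x, h (j x) = f x.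

Definition inclusion_factors_through_free
    M (S : pred M) (N : subLmodType S) : Prop :=
  exists F (u : {linear N -> F}) (v : {linear F -> M}),
    free_module F /\ forall x : N, v (u x) = val x.

Definition finitely_projective M : Prop :=
  forall (S : pred M) (N : subLmodType S),
    finitely_generated N -> inclusion_factors_through_free N.

Definition singly_projective M : Prop :=
  forall (S : pred M) (N : subLmodType S),
    cyclic_module N -> inclusion_factors_through_free N.

End Modules.

(* Ideals of R are the submodules of the regular module R^o. *)
Definition semihereditary (R : comPzRingType) : Prop :=
  forall (S : pred R^o) (I : subLmodType S),
    finitely_generated I -> projective_module I.

Definition pi_coherent (R : comPzRingType) : Prop :=
  forall (L : Type) (S : pred (L -> R^o)) (N : subLmodType S),
    finitely_generated N -> finitely_presented N.

Definition self_injective (R : comPzRingType) : Prop :=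
  @injective_module R R^o.

(* The total quotient ring: pairs (a, s) with s a non-zero-divisor           *)
(* (GRing.lreg s, i.e. multiplication by s is injective), modulo             *)
(* (a, s) ~ (b, t) iff a t = s b; as t s is a non-zero-divisor, the usual    *)
(* extra multiplier in this relation is not needed.                          *)
Module TotalQuotient.
Section TotalQuotient.
Variable R : comPzRingType.

Record ratio := Ratio { frac :> R * R; _ : `[< GRing.lreg frac.2 >] }.

HB.instance Definition _ := [isSub for frac].
HB.instance Definition _ := [Choice of ratio by <:].

Implicit Types x y z : ratio.

Lemma denomP x : GRing.lreg x.2. Proof. by case: x => ? /= /asboolP. Qed.

Arguments denomP : clear implicits.

Definition mkratio (a s : R) (hs : GRing.lreg s) : ratio :=
  @Ratio (a, s) (asboolT hs).

Definition equivf x y := x.1 * y.2 == x.2 * y.1.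

Lemma equivf_refl : reflexive equivf.
Proof. by move=> x; rewrite /equivf mulrC. Qed.

Lemma equivf_sym : symmetric equivf.
Proof. by move=> x y; rewrite /equivf eq_sym; congr (_ == _); rewrite mulrC. Qed.

Lemma equivf_trans : transitive equivf.
Proof.
move=> y x z; rewrite /equivf => /eqP xy /eqP yz; apply/eqP.
by apply: (denomP y); rewrite mulrA [_ * x.1]mulrC xy -mulrA yz mulrCA.
Qed.

Canonical equivf_equiv := EquivRel equivf equivf_refl equivf_sym equivf_trans.

Definition type := {eq_quot equivf}.

HB.instance Definition _ : EqQuotient _ equivf type := EqQuotient.on type.
HB.instance Definition _ := Choice.on type.

Lemma eq_typeP x y :
  reflect (x.1 * y.2 = x.2 * y.1) (\pi_type x == \pi_type y).
Proof. by rewrite eqmodE; apply: eqP. Qed.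

Lemma reprE x :
  x.1 * (repr (\pi_type x)).2 = x.2 * (repr (\pi_type x)).1.
Proof. by apply/eq_typeP; rewrite reprK. Qed.

Definition addf x y : ratio :=
  mkratio (x.1 * y.2 + y.1 * x.2) (GRing.lregM (denomP x) (denomP y)).
Definition oppf x : ratio := mkratio (- x.1) (denomP x).
Definition mulf x y : ratio :=
  mkratio (x.1 * y.1) (GRing.lregM (denomP x) (denomP y)).
Definition inf (a : R) : ratio := mkratio a (@GRing.lreg1 R).

Definition add (p q : type) : type := \pi_type (addf (repr p) (repr q)).
Definition opp (p : type) : type := \pi_type (oppf (repr p)).
Definition mul (p q : type) : type := \pi_type (mulf (repr p) (repr q)).
Definition tofrac (a : R) : type := \pi_type (inf a).

Lemma pi_addE x y : add (\pi_type x) (\pi_type y) = \pi_type (addf x y).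
Proof.
apply/eqP/eq_typeP => /=.
by have hx := reprE x; have hy := reprE y; ring: hx hy.
Qed.

Lemma pi_oppE x : opp (\pi_type x) = \pi_type (oppf x).
Proof. by apply/eqP/eq_typeP => /=; have hx := reprE x; ring: hx. Qed.

Lemma pi_mulE x y : mul (\pi_type x) (\pi_type y) = \pi_type (mulf x y).
Proof.
by apply/eqP/eq_typeP => /=; have hx := reprE x; have hy := reprE y; ring: hx hy.
Qed.

Lemma addA : associative add.
Proof.
elim/quotW=> x; elim/quotW=> y; elim/quotW=> z.
rewrite (pi_addE y z) (pi_addE x y) (pi_addE x (addf y z)).
by rewrite (pi_addE (addf x y) z); apply/eqP/eq_typeP => /=; ring.
Qed.

Lemma addC : commutative add.
Proof.
elim/quotW=> x; elim/quotW=> y; rewrite (pi_addE x y) (pi_addE y x).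
by apply/eqP/eq_typeP => /=; ring.
Qed.

Lemma add0r : left_id (tofrac 0) add.
Proof.
elim/quotW=> x; rewrite (pi_addE (inf 0) x).
by apply/eqP/eq_typeP => /=; ring.
Qed.

Lemma addNr : left_inverse (tofrac 0) opp add.
Proof.
elim/quotW=> x; rewrite (pi_oppE x) (pi_addE (oppf x) x).
by apply/eqP/eq_typeP => /=; ring.
Qed.

HB.instance Definition _ := GRing.isZmodule.Build type addA addC add0r addNr.

Lemma mulA : associative mul.
Proof.
elim/quotW=> x; elim/quotW=> y; elim/quotW=> z.
rewrite (pi_mulE y z) (pi_mulE x y) (pi_mulE x (mulf y z)).
by rewrite (pi_mulE (mulf x y) z); apply/eqP/eq_typeP => /=; ring.
Qed.

Lemma mulC : commutative mul.
Proof.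
elim/quotW=> x; elim/quotW=> y; rewrite (pi_mulE x y) (pi_mulE y x).
by apply/eqP/eq_typeP => /=; ring.
Qed.

Lemma mul1r : left_id (tofrac 1) mul.
Proof.
elim/quotW=> x; rewrite (pi_mulE (inf 1) x).
by apply/eqP/eq_typeP => /=; ring.
Qed.

Lemma mulDl : left_distributive mul add.
Proof.
elim/quotW=> x; elim/quotW=> y; elim/quotW=> z.
rewrite (pi_addE x y) (pi_mulE (addf x y) z) (pi_mulE x z) (pi_mulE y z).
by rewrite (pi_addE (mulf x z) (mulf y z)); apply/eqP/eq_typeP => /=; ring.
Qed.

HB.instance Definition _ :=
  GRing.Zmodule_isComPzRing.Build type mulA mulC mul1r mulDl.

Fact tofrac_is_zmod_morphism : zmod_morphism tofrac.
Proof.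
move=> a b; rewrite -[RHS]/(add (tofrac a) (opp (tofrac b))).
rewrite (pi_oppE (inf b)) (pi_addE (inf a) (oppf (inf b))).
by apply/eqP/eq_typeP => /=; ring.
Qed.

Fact tofrac_is_monoid_morphism : monoid_morphism tofrac.
Proof.
split=> // a b; rewrite -[RHS]/(mul (tofrac a) (tofrac b)).
by rewrite (pi_mulE (inf a) (inf b)); apply/eqP/eq_typeP => /=; ring.
Qed.

HB.instance Definition _ :=
  GRing.isZmodMorphism.Build R type tofrac tofrac_is_zmod_morphism.
HB.instance Definition _ :=
  GRing.isMonoidMorphism.Build R type tofrac tofrac_is_monoid_morphism.

Lemma tofrac_injective : injective tofrac.
Proof. by move=> a b /eqP/eq_typeP /=; rewrite mulr1 GRing.mul1r. Qed.

Lemma tofrac_invertible (s : R) :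
  GRing.lreg s -> exists q : type, tofrac s * q = 1.
Proof.
move=> hs; exists (\pi_type (mkratio 1 hs)).
rewrite -[LHS]/(mul (\pi_type (inf s)) _) (pi_mulE (inf s) (mkratio 1 hs)).
by apply/eqP/eq_typeP => /=; ring.
Qed.

Lemma tofrac_fraction (q : type) :
  exists a s : R, GRing.lreg s /\ tofrac s * q = tofrac a.
Proof.
elim/quotW: q => x; exists x.1, x.2; split; first exact: denomP.
rewrite -[LHS]/(mul (\pi_type (inf x.2)) _) (pi_mulE (inf x.2) x).
by apply/eqP/eq_typeP => /=; ring.
Qed.

End TotalQuotient.
End TotalQuotient.
HB.export TotalQuotient.

Notation total_quotient_ring := TotalQuotient.type.

(* Main.v *)
(** [Q] is von Neumann regular, because annihilators of elements of [R] are
    generated by idempotents.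

    If [Q] is self injective, the annihilator of any subset of [Q] is generated
    by an idempotent, and, by induction on [n], a submodule [K] of [Q^n] such
    that annihilators of elements of [Q^n / K] are generated by idempotents is
    the kernel of an idempotent matrix.  Let [N = R^n / K0] be a module in which
    the annihilator of each element is the annihilator of a subset of [R].
    Applied to [Q K0], this yields, after clearing denominators, a matrix over
    [R] with kernel [K0]; as [R] is semihereditary, [K0] is then a direct summand
    of [R^n].  So [N] is projective and finitely presented.  This covers the
    finitely generated submodules of [R^L] and those of singly projective
    modules.

    Conversely, let [f] be a homomorphism from an ideal of [Q] to [Q], and let
    [(b_l, a_l)] be the pairs in [R * R] with [f b_l = a_l].  The module of
    relations between [(a_l)_l] and [(b_l)_l] in [R^L] contains every
    [(b_l, - a_l)].  When it is finitely generated, say by the [(c_k, d_k)],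
    there are [t_k] in [Q] such that [e = sum_k t_k c_k] fixes all [b_l], and [f]
    is multiplication by [- sum_k t_k d_k]. *)
Require Import Defs.
From HB Require Import structures.
From mathcomp Require Import all_boot all_algebra.
From mathcomp Require Import ring boolp classical_sets functions.

Set Implicit Arguments.
Unset Strict Implicit.
Unset Printing Implicit Defensive.

Import GRing.Theory.
Local Open Scope ring_scope.
Local Open Scope classical_set_scope.

(** * Submodules, spans and linear maps given by their graphs *)

Definition submodule (R : comPzRingType) (M : lmodType R) (G : set M) : Prop :=
  G 0 /\ forall a u v, G u -> G v -> G (a *: u + v).

Definition set_pred (M : Type) (G : set M) : pred M := fun u => `[< G u >].

Lemma sub_lmod_exists (R : comPzRingType) (M : lmodType R) (G : set M) :
  submodule G -> inhabited (subLmodType (set_pred G)).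
Proof.
move=> [G0 GL].
have hS : GRing.subsemimod_closed (set_pred G).
  split; [split; first exact/asboolP | ].
    move=> u v /asboolP hu /asboolP hv; apply/asboolP.
    by rewrite -[u]scale1r; apply: GL.
  move=> a u /asboolP hu; apply/asboolP.
  by rewrite -[_ *: _]addr0; apply: GL.
pose T := {u : M | set_pred G u}.
pose m := GRing.SubChoice_isSubLmodule.Build R M (set_pred G) T hS.
pose N : subLmodType (set_pred G) := HB.pack T m.
exact: (inhabits N).
Qed.

Section Span.
Variables (R : comPzRingType) (M : lmodType R).

Lemma lin_span_submodule n (x : 'I_n -> M) : submodule (lin_span x).
Proof.
split; first by exists (fun=> 0); rewrite big1 // => i _; rewrite scale0r.
move=> a _ _ [c ->] [d ->]; exists (fun i => a * c i + d i).
rewrite scaler_sumr -big_split /=; apply: eq_bigr => i _.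
by rewrite scalerDl scalerA.
Qed.

Lemma lin_span_gen n (x : 'I_n -> M) i : lin_span x (x i).
Proof.
exists (fun j => (j == i)%:R); rewrite (bigD1 i) //= eqxx scale1r big1 ?addr0 // => j.
by move=> /negPf ->; rewrite scale0r.
Qed.

(** Allows linear maps to be defined through arbitrary preimages: triviality over [0] makes the
    relation [G] single-valued. *)
Lemma linear_of_graph (N : lmodType R) (G : M -> N -> Prop) :
  (forall x, exists y, G x y) ->
  (forall a x y x' y', G x y -> G x' y' -> G (a *: x + x') (a *: y + y')) ->
  (forall y, G 0 y -> y = 0) ->
  exists f : {linear M -> N}, forall x, G x (f x).
Proof.
move=> /boolp.choice[f hf] GL G0.
have Gfun x y y' : G x y -> G x y' -> y = y'.
  move=> h h'; have := GL (- 1) _ _ _ _ h' h.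
  by rewrite !scaleN1r addNr => /G0/eqP; rewrite addrC subr_eq0 => /eqP.
have flin : linear f.
  by move=> a u v; apply: (Gfun _ _ _ (hf _)); apply: GL; apply: hf.
pose fM := GRing.isLinear.Build R M N *:%R f flin.
pose g : {linear M -> N} := HB.pack f fM.
by exists g.
Qed.

End Span.

Lemma fg_surj (R : comPzRingType) (M : lmodType R) n (x : 'I_n -> M) :
  lin_span x = setT ->
  exists p : {linear 'rV[R]_n -> M},
    (forall v, p v = \sum_i v 0 i *: x i) /\ forall y, exists v, p v = y.
Proof.
move=> hx.
have [|||p hp] := @linear_of_graph R 'rV[R]_n M
  (fun (v : 'rV[R]_n) y => y = \sum_i v 0 i *: x i).
- by move=> v; eexists.
- move=> a u _ v _ -> ->; rewrite scaler_sumr -big_split /=.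
  by apply: eq_bigr => i _; rewrite !mxE scalerDl scalerA.
- by rewrite big1 // => i _; rewrite mxE scale0r.
exists p; split=> // y; have [c ->] : lin_span x y by rewrite hx.
exists (\row_i c i); rewrite hp; apply: eq_bigr => i _; by rewrite mxE.
Qed.

Lemma span_lmod_exists (R : comPzRingType) (M : lmodType R) n (x : 'I_n -> M) :
  exists (N : subLmodType (set_pred (lin_span x))) (p : {linear 'rV[R]_n -> N}),
    [/\ finitely_generated N, forall y, exists v, p v = y
      & forall v, val (p v) = \sum_i v 0 i *: x i].
Proof.
have [N] := sub_lmod_exists (lin_span_submodule x).
have h i : set_pred (lin_span x) (x i) by apply/asboolP/lin_span_gen.
pose y i : N := Sub (x i) (h i).
have valy (c : 'I_n -> R) : val (\sum_i c i *: y i) = \sum_i c i *: x i.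
  by rewrite raddf_sum /=; apply: eq_bigr => i _; rewrite linearZ /= SubK.
have yN : lin_span y = setT.
  rewrite -subTset => z _.
  have /asboolP[c hc] : set_pred (lin_span x) (val z) := valP z.
  by exists c; apply: val_inj; rewrite hc valy.
have [p [pE psurj]] := fg_surj yN.
exists N, p; split=> // [|v]; first by exists n, y.
by rewrite pE valy.
Qed.

(* Baer's criterion, with a homomorphism from an ideal presented by its graph. *)
Lemma self_injectiveP (A : comPzRingType) :
  self_injective A <->
  forall G : set (A^o * A^o), submodule G -> (forall y, G (0, y) -> y = 0) ->
    exists q : A, forall x y, G (x, y) -> y = x * q.
Proof.
split=> [inj G Gsub G0|ext M N j f jinj].
  have [D] := sub_lmod_exists Gsub.
  have DG (z : D) : G (val z) by apply/asboolP; exact: (valP z).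
  have jl : linear (fun z : D => (val z).1) by move=> a u v; rewrite linearP.
  have fl : linear (fun z : D => (val z).2) by move=> a u v; rewrite linearP.
  (* Both projections are taken on the graph itself; the first is injective by [G0], and the second
     is to be extended along it. *)
  pose j : {linear D -> A^o} := HB.pack (fun z : D => (val z).1)
    (GRing.isLinear.Build A D A^o *:%R _ jl).
  pose f : {linear D -> A^o} := HB.pack (fun z : D => (val z).2)
    (GRing.isLinear.Build A D A^o *:%R _ fl).
  have jinj : injective j.
    move=> u v; rewrite /j /= => e; apply: val_inj.
    case: Gsub => _ /(_ (- 1) (val v) (val u) (DG v) (DG u)).
    rewrite scaleN1r [_ + _]surjective_pairing /= e addNr => /G0 /eqP.
    rewrite addrC subr_eq0 => /eqP; move: e.
    by case: (val u) (val v) => [? ?] [? ?] /= -> ->.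
  have [h hh] := inj _ _ j f jinj.
  exists (h 1) => x y Gxy.
  have Sxy : set_pred G (x, y) by apply/asboolP.
  have := hh (Sub (x, y) Sxy); rewrite /j /f /= SubK /= => <-.
  by rewrite -[in LHS](mulr1 x) -[x * 1]/(x *: (1 : A^o)) linearZ.
pose good (G : set (N * A^o)) := [/\ forall x, G (j x, f x),
  submodule G & forall y, G (0, y) -> y = 0].
pose gr : set (N * A^o) := [set z | exists x, z = (j x, f x)].
have gr_good : good gr.
  split; first by move=> x; exists x.
    split; first by exists 0; rewrite !linear0.
    by move=> a _ _ [u ->] [v ->]; exists (a *: u + v); rewrite !linearP.
  by move=> y [x [/esym]]; rewrite -(linear0 j) => /jinj -> ->; rewrite linear0.
have [|G [PG Gmax]] := @Zorn_bigcup _ (fun G => G = set0 \/ good G).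
  move=> F FP Ftot.
  have [[G0 [FG0 gG0]]|nF] := pselect (exists G, F G /\ good G); last first.
    left; rewrite -subset0 => z [G FG Gz].
    by case: (FP _ FG) => [e|gG]; [rewrite e in Gz | case: nF; exists G].
  have Fgood G z : F G -> G z -> good G.
    by move=> FG Gz; case: (FP _ FG) => // e; rewrite e in Gz.
  right; split.
  - by move=> x; exists G0 => //; case: gG0.
  - split; first by exists G0 => //; case: gG0 => _ [].
    move=> a u v [U FU Uu] [V FV Vv].
    have [UV|VU] := Ftot _ _ FU FV.
      exists V => //; have [_ [_ h] _] := Fgood _ _ FV Vv.
      by apply: h => //; apply: UV.
    exists U => //; have [_ [_ h] _] := Fgood _ _ FU Uu.
    by apply: h => //; apply: VU.
  - by move=> y [U FU Uy]; have [_ _ h] := Fgood _ _ FU Uy; apply: h.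
have gG : good G.
  case: PG => // e; case: (Gmax gr); last by right.
  rewrite e; split; first exact: sub0set.
  by move=> /(_ (j 0, f 0)) h; apply: h; exists 0.
case: (gG) => Gjf [G0 GL] Gfun.
have [n|a x y x' y' h h'||h hh] :=
    linear_of_graph (G := fun n (y : A^o) => G (n, y)); first last.
- exists h => x; have := GL (- 1) _ _ (hh (j x)) (Gjf x).
  rewrite scaleN1r [_ + _]surjective_pairing /= addNr => /Gfun /eqP.
  by rewrite addrC subr_eq0 => /eqP.
- exact: Gfun.
- exact: (GL a (x, y) (x', y')).
(* The scalars [t] with [t *: n] in the domain of [G] form an ideal; the map that [G] induces on it
   is multiplication by [q], the value to be given to [n]. *)
have [||q hq] := ext [set z : A^o * A^o | G (z.1 *: n, z.2)].
- split=> /=; first by rewrite scale0r.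
  move=> a [u1 u2] [v1 v2] /= hu hv.
  by rewrite scalerDl -scalerA; apply: (GL a (u1 *: n, u2) (v1 *: n, v2)).
- by move=> y /=; rewrite scale0r => /Gfun.
pose G' : set (N * A^o) :=
  [set z | exists m y t, G (m, y) /\ z = (m + t *: n, y + t * q)].
have GG' : G `<=` G'.
  move=> [m y] h; exists m, y, 0; split=> //.
  by rewrite scale0r mul0r !addr0.
have gG' : good G'.
  split; first by move=> x; apply: GG'.
    split; first exact: GG'.
    move=> a _ _ [m [y [t [h ->]]]] [m' [y' [t' [h' ->]]]].
    exists (a *: m + m'), (a *: y + y'), (a * t + t'); split.
      exact: (GL a (m, y) (m', y')).
    congr (_, _).
      by rewrite /= scalerDr scalerDl scalerA addrACA.
    by rewrite /= scalerDr mulrDl -mulrA addrACA.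
  move=> _ [m [y [t [h [/esym e ->]]]]].
  have -> : y = (- t) * q.
    apply: hq => /=; move: h; rewrite scaleNr; move/eqP: e.
    by rewrite addr_eq0 => /eqP ->.
  by rewrite mulNr addNr.
exists q; case: (pselect (G' `<=` G)) => [h|h].
  by apply: h; exists 0, 0, 1; rewrite scale1r mul1r !add0r.
by case: (Gmax G'); [split | right].
Qed.

(** * Kernels of matrices over a semihereditary ring *)

(** The ideal generated by the entries of [a] is projective, so the surjection [p0] onto it has a
    section [h], and [1 - h p0] projects onto the kernel. *)
Lemma column_kernel_retraction (R : comPzRingType) (hR : semihereditary R)
    n (a : 'cV[R]_n) :
  exists S : 'M[R]_n, S *m a = 0 /\
    forall c : 'rV[R]_n, c *m a = 0 -> c *m S = c.
Proof.
have [I [p0 [Ifg p0_surj p0v]]] := span_lmod_exists (fun i => a i 0 : R^o).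
have p0E c : val (p0 c) = (c *m a) 0 0 by rewrite p0v mxE.
have [h hh] := hR _ I Ifg _ _ p0 (idfun : {linear I -> I}) p0_surj.
exists (1%:M - lin1_mx (h \o p0)).
have SE (c : 'rV[R]_n) : c *m (1%:M - lin1_mx (h \o p0)) = c - h (p0 c).
  by rewrite mulmxBr mulmx1 mul_rV_lin1.
split=> [|c ca]; last first.
  rewrite SE; have -> : p0 c = 0 by apply: val_inj; rewrite p0E ca mxE raddf0.
  by rewrite linear0 subr0.
apply/row_matrixP => i; rewrite row_mul row0 rowE -mulmxA.
rewrite mulmxA SE; apply/matrixP => j k; rewrite !ord1 -p0E linearB.
by rewrite hh /= subrr raddf0 mxE.
Qed.

(** Column by column: [S1] projects onto the kernel of the first column and [S2] onto that of
    [S1 *m B]; the last factor of [S1 *m S2 *m S1] brings rows back into the first kernel. *)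
Lemma kernel_retraction (R : comPzRingType) (hR : semihereditary R)
    n m (A : 'M[R]_(n, m)) :
  exists S : 'M[R]_n, S *m A = 0 /\
    forall c : 'rV[R]_n, c *m A = 0 -> c *m S = c.
Proof.
elim: m A => [|m IH].
  move=> A; exists 1%:M; split; first exact: thinmx0.
  by move=> c _; rewrite mulmx1.
rewrite -[m.+1]/(1 + m)%N => A; rewrite -[A]hsubmxK.
set a := lsubmx _; set B := rsubmx _.
have [S1 [S1a hS1]] := column_kernel_retraction hR a.
have [S2 [S2B hS2]] := IH (S1 *m B).
exists (S1 *m S2 *m S1); split=> [|c].
  by rewrite mul_mx_row -!mulmxA S1a S2B !mulmx0 row_mx0.
rewrite mul_mx_row -[0]row_mx0 => /eq_row_mx[ca cB].
have cS1 := hS1 _ ca.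
by rewrite !mulmxA cS1 hS2 ?cS1 // mulmxA cS1.
Qed.

(** * Clearing denominators *)

Section Denominators.
Variable R : comPzRingType.
Local Notation Q := (total_quotient_ring R).
Local Notation iota := (@TotalQuotient.tofrac R).

Lemma tofrac_lreg (s : R) : GRing.lreg s -> GRing.lreg (iota s).
Proof.
move=> /TotalQuotient.tofrac_invertible[t st] x y e.
by rewrite -[x]mul1r -[y]mul1r -st [_ * t]mulrC -!mulrA e.
Qed.

Lemma mx_common_denominator m n (A : 'M[Q]_(m, n)) :
  exists s (B : 'M[R]_(m, n)), GRing.lreg s /\ iota s *: A = map_mx iota B.
Proof.
have [f hf] := boolp.choice (fun ij : 'I_m * 'I_n =>
  TotalQuotient.tofrac_fraction (A ij.1 ij.2)).
have [g hg] := boolp.choice hf.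
(* The product of the denominators of all entries; each numerator is multiplied by the other
   denominators. *)
exists (\prod_ij g ij), (\matrix_(i, j)
  (f (i, j) * \prod_(kl | kl != (i, j)) g kl)); split.
  by elim/big_rec: _ => [|i x _ hx]; [exact: GRing.lreg1
    | apply: GRing.lregM => //; case: (hg i)].
apply/matrixP => i j; rewrite !mxE rmorphM (bigD1 (i, j)) //= rmorphM /=.
by rewrite mulrAC; case: (hg (i, j)) => _ ->.
Qed.

End Denominators.

(** * Von Neumann regularity of the total quotient ring *)

Section Semihereditary.
Variables (R : comPzRingType) (hR : semihereditary R).
Local Notation Q := (total_quotient_ring R).
Local Notation iota := (@TotalQuotient.tofrac R).

(** The kernel retraction for a single entry; [c = s] shows that [s] is idempotent. *)
Lemma annihilator_idempotent (a : R) :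
  exists s, s * a = 0 /\ forall c, c * a = 0 -> c * s = c.
Proof.
have [S [Sa hS]] := column_kernel_retraction hR (a%:M : 'cV_1).
exists (S 0 0); split=> [|c ca].
  have := congr1 (fun A : 'M_1 => A 0 0) Sa.
  by rewrite [S]mx11_scalar -scalar_mxM !mxE eqxx.
have := hS c%:M; rewrite -scalar_mxM ca [0%:M]raddf0 => /(_ erefl).
rewrite {1}[S]mx11_scalar -scalar_mxM => /(congr1 (fun A : 'M_1 => A 0 0)).
by rewrite !mxE eqxx.
Qed.

Lemma semihereditary_reduced (a : R) : a * a = 0 -> a = 0.
Proof.
by have [s [sa hs]] := annihilator_idempotent a => /hs <-; rewrite mulrC.
Qed.

Lemma total_quotient_reduced (x : Q) : x * x = 0 -> x = 0.
Proof.
have [a [s [sreg sx]]] := TotalQuotient.tofrac_fraction x.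
move=> xx; apply: (tofrac_lreg sreg); rewrite mulr0 sx.
have -> : a = 0; last by rewrite rmorph0.
apply: semihereditary_reduced; apply: TotalQuotient.tofrac_injective.
by rewrite rmorph0 rmorphM /= -sx mulrACA xx mulr0.
Qed.

Lemma total_quotient_regular (x : Q) : exists y, x * y * x = x.
Proof.
have [a [s [sreg sx]]] := TotalQuotient.tofrac_fraction x.
have [e [ea he]] := annihilator_idempotent a.
(* [e] generates the annihilator of [a], so [a + e] is a non-zero-divisor. *)
have areg : GRing.lreg (a + e).
  suff h r : (a + e) * r = 0 -> r = 0.
    move=> u v /eqP; rewrite -subr_eq0 -mulrBr => /eqP/h/eqP.
    by rewrite subr_eq0 => /eqP.
  move=> er; have ar : a * r = 0.
    apply: semihereditary_reduced.
    rewrite [LHS](_ : _ = a * r * ((a + e) * r) - e * a * r * r); last by ring.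
    by rewrite er ea mulr0 !mul0r subrr.
  rewrite -[r]he 1?mulrC //.
  by move: er; rewrite mulrDl ar add0r.
have [b ab] := TotalQuotient.tofrac_invertible areg.
have [t st] := TotalQuotient.tofrac_invertible sreg.
(* As [x = a / s] and [a * a * b = a], this is a quasi-inverse of [x]. *)
exists (iota s * b); apply: (tofrac_lreg sreg).
have eaQ : iota e * iota a = 0 by rewrite -rmorphM ea rmorph0.
rewrite sx [LHS](_ : _ = (iota s * x) * (iota s * x) * b); last by ring.
rewrite sx -[RHS]mulr1 -ab rmorphD /= mulrA mulrDr.
by rewrite [iota a * iota e]mulrC eaQ addr0.
Qed.

(** By regularity, generators can be added one at a time; the sum is an idempotent generating the
    ideal. *)
Lemma fg_ideal_unit n (c : 'I_n -> Q) :
  exists t : 'I_n -> Q, forall k, (\sum_i t i * c i) * c k = c k.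
Proof.
elim: n c => [|n IH] c; first by exists (fun=> 0) => -[].
have [t ht] := IH (fun i => c (lift ord0 i)).
set e := \sum_i _ in ht.
have [y hy] := total_quotient_regular ((1 - e) * c ord0).
(* Chosen so that [1 - sum = (1 - e) * (1 - y * (1 - e) * c ord0)]. *)
exists (fun i => if unlift ord0 i is Some j
  then t j * (1 - y * (1 - e) * c ord0) else y * (1 - e)) => k.
rewrite big_ord_recl unlift_none.
under eq_bigr do rewrite liftK mulrAC.
rewrite -mulr_suml -/e.
case: (unliftP ord0 k) => [j ->|->].
  have /= := ht j; set u := c ord0; set v := c _ => hv.
  rewrite [LHS](_ : _ = e * v + y * (1 - e) * u * (v - e * v)); last by ring.
  by rewrite hv subrr mulr0 addr0.
set u := c ord0 in hy *; apply/eqP; rewrite -subr_eq0; apply/eqP.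
rewrite [LHS](_ : _ = (1 - e) * u * y * ((1 - e) * u) - (1 - e) * u).
  by rewrite hy subrr.
by ring.
Qed.

End Semihereditary.

(** * Annihilators and nonsingular quotients over a reduced self injective ring *)

Section SelfInjective.
Variables (A : comPzRingType) (injA : self_injective A).

Lemma row_extension n (G : set (A^o * 'rV[A]_n)) :
  submodule G -> (forall y, G (0, y) -> y = 0) ->
  exists w : 'rV_n, forall t y, G (t, y) -> y = t *: w.
Proof.
move=> [G0 GL] Gfun.
have ex i : exists q : A, forall t y, G (t, y) -> y 0 i = t * q.
  have [||q hq] := (self_injectiveP A).1 injA
    [set z | exists2 y, G (z.1, y) & z.2 = y 0 i].
  - split; first by exists 0 => //; rewrite mxE.
    move=> a [t1 b1] [t2 b2] [y /= hy ->] [z /= hz ->].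
    by exists (a *: y + z); [exact: (GL a (t1, y) (t2, z)) | rewrite !mxE].
  - by move=> b [y /Gfun -> /= ->]; rewrite mxE.
  by exists q => t y h; apply: hq; exists y.
have [q hq] := boolp.choice ex.
exists (\row_i q i) => t y h; apply/rowP => i.
by rewrite !mxE; apply: hq.
Qed.

Hypothesis redA : forall x : A, x * x = 0 -> x = 0.

(** Reducedness makes the sum of the annihilator of [X] and its own annihilator direct. Projection
    onto the former is multiplication by some [q], an idempotent generating it, and [f = 1 - q]. *)
Lemma annihilator_of_idempotent (X : set A) :
  exists f, f * f = f /\ forall t, (forall x, X x -> t * x = 0) <-> t * f = 0.
Proof.
pose ann (t : A) := forall x, X x -> t * x = 0.
have [||q hq] := (self_injectiveP A).1 injA
  [set z | ann z.2 /\ forall a, ann a -> a * (z.1 - z.2) = 0].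
- split; first by split=> [x _|a _] /=; rewrite ?subrr ?mul0r ?mulr0.
  move=> a [u1 u2] [v1 v2] /= [hu hu'] [hv hv']; split=> [x Xx|b hb].
    by rewrite mulrDl -mulrA hu // hv // mulr0 addr0.
  rewrite [LHS](_ : _ = a * (b * (u1 - u2)) + b * (v1 - v2)).
    by rewrite hu' // hv' // mulr0 addr0.
  by rewrite -![_ *: _]/(_ * _); ring.
- move=> y [/= hy /(_ y hy)]; rewrite sub0r mulrN => /eqP.
  by rewrite oppr_eq0 => /eqP; apply: redA.
have qann : ann q.
  move=> x Xx; rewrite mulrC -(hq x 0) //; split=> [z _|a ha] /=.
    by rewrite mul0r.
  by rewrite subr0 ha.
have annq t : ann t -> t = t * q.
  by move=> ht; apply: hq; split=> // a _; rewrite subrr mulr0.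
exists (1 - q); split=> [|t].
  by rewrite mulrBr mulr1 mulrBl mul1r -annq // subrr subr0.
split=> [/annq|]; first by rewrite mulrBr mulr1 => <-; rewrite subrr.
move=> /eqP; rewrite mulrBr mulr1 subr_eq0 => /eqP -> x Xx.
by rewrite -mulrA qann // mulr0.
Qed.

(* The hypothesis says that [A^n / K] is nonsingular: the annihilator of each *)
(* of its elements is generated by an idempotent.                             *)
Lemma nonsingular_kernel n (K : set 'rV[A]_n) :
  submodule K ->
  (forall c, exists f, forall t, K (t *: c) <-> t * f = 0) ->
  exists E : 'M[A]_n, E *m E = E /\ forall c, K c <-> c *m E = 0.
Proof.
(* Each [f] can be replaced by an idempotent with the same annihilator. *)
suff : submodule K ->
  (forall c, exists f, f * f = f /\ forall t, K (t *: c) <-> t * f = 0) ->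
  exists E : 'M[A]_n, E *m E = E /\ forall c, K c <-> c *m E = 0.
  move=> h sK nK; apply: h => // c; have [f hf] := nK c.
  have [g [gg hg]] := annihilator_of_idempotent [set f].
  exists g; split=> // t; rewrite hf -hg.
  by split=> [tf _ -> //|]; apply.
elim: n K => [|n IH].
  move=> K [K0 _] _; exists 0; split; first by rewrite mul0mx.
  by move=> c; rewrite (thinmx0 c) mul0mx.
rewrite -[n.+1]/(1 + n)%N => K [K0 KL] nK.
(* [E] describes the elements of [K] with first coordinate [0]. *)
have [||E [EE hE]] := IH [set c' | K (row_mx 0 c')].
- split=> /=; first by rewrite row_mx0.
  move=> a u v hu hv; have := KL a _ _ hu hv.
  by rewrite scale_row_mx add_row_mx scaler0 addr0.
- move=> c; have [f [ff hf]] := nK (row_mx 0 c).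
  exists f; split=> // t; rewrite -hf.
  by rewrite scale_row_mx scaler0.
(* For [(t, c')] in [K], the row [c' *m E] depends only on [t], linearly; by injectivity it is
   [t *: w0]. *)
have [||w0 hw0] := row_extension (G := [set z : A^o * 'rV[A]_n |
    exists2 c', K (row_mx (z.1 : A)%:M c') & z.2 = c' *m E]).
- split; first by exists 0; rewrite ?mul0mx //= raddf0 row_mx0.
  move=> a [t1 b1] [t2 b2] [u /= hu ->] [v /= hv ->].
  exists (a *: u + v); last by rewrite mulmxDl scalemxAl.
  have := KL a _ _ hu hv.
  by rewrite scale_row_mx add_row_mx scale_scalar_mx -raddfD.
- by move=> b [c /= + ->]; rewrite raddf0 => /hE.
pose w := w0 *m E; have wE : w *m E = w by rewrite -mulmxA EE.
have hw t c : K (row_mx t%:M c) -> c *m E = t *: w.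
  move=> h; have -> : c *m E = (c *m E) *m E by rewrite -mulmxA EE.
  by rewrite (hw0 t (c *m E)) ?scalemxAl //; exists c.
(* [f] decides which multiples of [(1, w)] lie in [K]. *)
have [f [ff hf]] := nK (row_mx 1%:M w).
have {}hf t : K (row_mx t%:M (t *: w)) <-> t * f = 0.
  by rewrite -hf scale_row_mx scale_scalar_mx mulr1.
have split_row t c : c *m E = t *: w ->
    K (row_mx t%:M c) <-> K (row_mx t%:M (t *: w)).
  move=> e; have h : K (row_mx 0 (c - t *: w)).
    by apply/hE; rewrite mulmxBl -scalemxAl wE e subrr.
  split=> h'; last first.
    have := KL 1 _ _ h h'.
    by rewrite scale1r add_row_mx add0r subrK.
  have := KL (- 1) _ _ h h'.
  by rewrite scaleN1r opp_row_mx add_row_mx oppr0 add0r opprB subrK.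
have key t c : K (row_mx t%:M c) <-> t * f = 0 /\ c *m E = t *: w.
  split=> [h|[tf e]]; last by apply: (split_row t c e).2; apply: (hf t).2.
  have e := hw _ _ h; split=> //.
  by apply: (hf t).1; apply: (split_row t c e).1.
(* The kernel is the one described by [key]: the factor [1 - f] has no effect when [t * f = 0], and
   it makes the matrix idempotent. *)
exists (block_mx f%:M (- ((1 - f) *: w)) 0 E); split.
  rewrite mulmx_block -scalar_mxM ff !mulmx0 !mul0mx !addr0 add0r EE.
  rewrite mul_scalar_mx scalerN scalerA mulrBr mulr1 ff subrr scale0r oppr0.
  by rewrite add0r mulNmx -scalemxAl wE.
move=> c; rewrite -[c]hsubmxK [lsubmx c]mx11_scalar; move: (lsubmx c 0 0) => t.
move: (rsubmx c) => {}c; rewrite key mul_row_block -scalar_mxM mulmx0 addr0.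
rewrite mul_scalar_mx scalerN scalerA mulrBr mulr1.
split=> [[-> ->]|].
  by rewrite raddf0 subr0 addNr row_mx0.
rewrite -[0]row_mx0 => /eq_row_mx[].
move=> /(congr1 (fun B : 'M_1 => B 0 0)); rewrite !mxE eqxx mulr1n => -> e.
by split=> //; move/eqP: e; rewrite subr0 addrC subr_eq0 => /eqP.
Qed.

End SelfInjective.

(** * Lifting and finite presentation *)

Lemma rV_lift (R : comPzRingType) (N : lmodType R) m n
    (f : {linear 'rV[R]_m -> N}) (g : {linear 'rV[R]_n -> N}) :
  (forall y, exists v, g v = y) ->
  exists U : 'M[R]_(m, n), forall w, g (w *m U) = f w.
Proof.
move=> gsurj; have [u hu] := boolp.choice (fun i => gsurj (f (delta_mx 0 i))).
exists (\matrix_i u i) => w; rewrite mulmx_sum_row linear_sum.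
rewrite [in RHS](row_sum_delta w) linear_sum; apply: eq_bigr => i _.
by rewrite rowK !linearZ /= hu.
Qed.

Lemma lin_span_rows (R : comPzRingType) m n (r : 'I_m -> 'rV[R]_n) v :
  lin_span r v <-> exists u : 'rV_m, v = u *m (\matrix_i r i).
Proof.
split=> [[c ->]|[u ->]].
  exists (\row_i c i); rewrite mulmx_sum_row.
  by apply: eq_bigr => i _; rewrite mxE rowK.
by exists (u 0); rewrite mulmx_sum_row; apply: eq_bigr => i _; rewrite rowK.
Qed.

(** Schanuel's argument: [U] and [V] translate between the two systems of generators, and the kernel
    is spanned by the translated relations and the rows of [1 - U V]. *)
Lemma finitely_presented_kernel (R : comPzRingType) (N : lmodType R) m
    (h : {linear 'rV[R]_m -> N}) :
  finitely_presented N -> (forall y, exists v, h v = y) ->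
  exists k (B : 'M[R]_(k, m)), forall w, h w = 0 <-> exists u, w = u *m B.
Proof.
move=> [n [g [gsurj [k [r rE]]]]] hsurj.
have kerg v : g v = 0 <-> exists u : 'rV_k, v = u *m (\matrix_i r i).
  by rewrite -lin_span_rows rE.
have [U hU] := rV_lift h gsurj; have [V hV] := rV_lift g hsurj.
exists (k + m)%N, (col_mx ((\matrix_i r i) *m V) (1%:M - U *m V)) => w.
split=> [hw|[u ->]].
  have [u wU] : exists u : 'rV_k, w *m U = u *m (\matrix_i r i).
    by apply/kerg; rewrite hU.
  exists (row_mx u w); rewrite mul_row_col mulmxA -wU mulmxBr mulmx1 mulmxA.
  by rewrite addrC subrK.
rewrite -[u]hsubmxK mul_row_col mulmxA linearD hV mulmxBr mulmx1 linearB.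
rewrite mulmxA hV hU subrr addr0.
by apply/kerg; eexists.
Qed.

(** * Splitting of nonsingular modules, and the equivalence *)

Section Equivalence.
Variables (R : comPzRingType) (hR : semihereditary R).
Local Notation Q := (total_quotient_ring R).
Local Notation iota := (@TotalQuotient.tofrac R).

Lemma map_tofrac_inj m n : injective (map_mx iota : 'M_(m, n) -> 'M_(m, n)).
Proof.
move=> A B /matrixP e; apply/matrixP => i j.
by apply: TotalQuotient.tofrac_injective; have := e i j; rewrite !mxE.
Qed.

Lemma fg_nonsingular_split (injQ : self_injective Q) (N : lmodType R) n
    (p : {linear 'rV[R]_n -> N}) :
  (forall y, exists v, p v = y) ->
  (forall y : N, exists X : set R,
     forall a, a *: y = 0 <-> forall x, X x -> a * x = 0) ->
  exists s : {linear N -> 'rV[R]_n}, forall y, p (s y) = y.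
Proof.
move=> psurj nsN; have redQ := total_quotient_reduced hR.
have torsionfree s (y : N) : GRing.lreg s -> s *: y = 0 -> y = 0.
  move=> sreg; have [X hX] := nsN y => /hX h; rewrite -[y]scale1r.
  by apply/hX => x /h sx; rewrite mul1r; apply: sreg; rewrite sx mulr0.
(* The [Q]-submodule of [Q^n] generated by the kernel of [p]. *)
pose K (c : 'rV[Q]_n) := exists s r,
  [/\ GRing.lreg s, iota s *: c = map_mx iota r & p r = 0].
have Ksub : submodule K.
  split.
    exists 1, 0; split; [exact: GRing.lreg1| |exact: linear0].
    by rewrite scaler0 map_mx0.
  move=> a u v [s [r [sreg su pr]]] [s' [r' [sreg' sv pr']]].
  have [b [q [qreg qa]]] := TotalQuotient.tofrac_fraction a.
  exists (q * (s * s')), ((b * s') *: r + (q * s) *: r'); split.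
  - by apply: GRing.lregM => //; apply: GRing.lregM.
  - rewrite map_mxD !map_mxZ -su -sv !scalerA scalerDr !scalerA.
    rewrite !rmorphM /= -qa.
    by congr (_ *: _ + _ *: _); ring.
  - by rewrite linearD !linearZ /= pr pr' !scaler0 addr0.
(* With [c = r / s] and [t = b / q], the row [t *: c] lies in [K] exactly when [b *: p r = 0], that
   is, when [t] annihilates the image of [X]. *)
have Kns c : exists f, forall t, K (t *: c) <-> t * f = 0.
  have [s [r [sreg sc]]] := mx_common_denominator c.
  have [X hX] := nsN (p r).
  have [f [_ hf]] := annihilator_of_idempotent injQ redQ (iota @` X).
  exists f => t; rewrite -hf.
  have [b [q [qreg qt]]] := TotalQuotient.tofrac_fraction t.
  have bX x : b * x = 0 <-> t * iota x = 0.
    split=> [bx|tx].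
      apply: (tofrac_lreg qreg); rewrite mulr0 mulrA qt -rmorphM bx.
      exact: rmorph0.
    apply: TotalQuotient.tofrac_injective.
    by rewrite rmorphM /= -qt -mulrA tx mulr0 rmorph0.
  have -> : (forall x, (iota @` X) x -> t * x = 0) <-> b *: p r = 0.
    rewrite hX; split=> [h x Xx|h _ [x Xx <-]]; apply/bX; last exact: h.
    by apply: h; exists x.
  split=> [[s1 [r1 [s1reg e1 pr1]]]|br]; last first.
    exists (q * s), (b *: r); split; first exact: GRing.lregM.
      by rewrite map_mxZ -sc !scalerA rmorphM /= -qt mulrAC.
    by rewrite linearZ.
  apply: (torsionfree s1) => //.
  rewrite scalerA -linearZ /=.
  have -> : (s1 * b) *: r = (q * s) *: r1.
    apply: map_tofrac_inj; rewrite !map_mxZ -sc -e1 !scalerA !rmorphM /= -qt.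
    by congr (_ *: _); ring.
  by rewrite linearZ /= pr1 scaler0.
have [E [_ hE]] := nonsingular_kernel injQ redQ Ksub Kns.
have [d [A [dreg dE]]] := mx_common_denominator E.
(* As [N] is torsion-free, [K] meets [R^n] in the kernel of [p]; so [A], a multiple of [E] with
   entries in [R], has this kernel. *)
have kerp c : p c = 0 <-> c *m A = 0.
  have -> : c *m A = 0 <-> K (map_mx iota c).
    rewrite hE; split=> [cA|cE].
      apply/rowP => j; apply: (tofrac_lreg dreg).
      have := congr1 (map_mx iota) cA.
      rewrite map_mxM -dE -scalemxAr map_mx0 => /rowP/(_ j).
      by rewrite !mxE mulr0.
    by apply: map_tofrac_inj; rewrite map_mxM -dE -scalemxAr cE scaler0 map_mx0.
  split=> [pc|[s [r [sreg]]]].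
    by exists 1, c; split=> //; [exact: GRing.lreg1 | rewrite rmorph1 scale1r].
  rewrite -map_mxZ => /map_tofrac_inj <-; rewrite linearZ /=.
  exact: torsionfree.
have [S [SA hS]] := kernel_retraction hR A.
(* Sending [p c] to [c - c *m S] is well defined, since [S] fixes the kernel of [p], and it is a
   section, since [S] takes its values there. *)
have [y|a x u x' u'|y|sec hsec] := @linear_of_graph R N 'rV[R]_n
  (fun y u => exists2 c, y = p c & u = c - c *m S).
- by have [c <-] := psurj y; exists (c - c *m S), c.
- move=> [c -> ->] [c' -> ->]; exists (a *: c + c'); first by rewrite linearP.
  by rewrite mulmxDl -scalemxAl scalerBr opprD addrACA.
- by move=> [c /esym/kerp/hS -> ->]; rewrite subrr.
exists sec => y; have [c -> ->] := hsec y.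
have /kerp pS : (c *m S) *m A = 0 by rewrite -mulmxA SA mulmx0.
by rewrite linearB pS subr0.
Qed.

Lemma split_finitely_presented (N : lmodType R) n (p : {linear 'rV[R]_n -> N})
    (s : {linear N -> 'rV[R]_n}) :
  (forall y, p (s y) = y) -> finitely_presented N.
Proof.
move=> ps; exists n, p; split; first by move=> y; exists (s y).
pose S := 1%:M - lin1_mx (s \o p).
have SE c : c *m S = c - s (p c) by rewrite mulmxBr mulmx1 mul_rV_lin1.
exists n, (fun i => row i S); rewrite predeqE => v; rewrite lin_span_rows /=.
have -> : \matrix_i row i S = S by apply/row_matrixP => i; rewrite rowK.
split=> [[u ->]|pv]; first by rewrite SE linearB ps subrr.
by exists v; rewrite SE pv linear0 subr0.
Qed.

Lemma self_injective_pi_coherent : self_injective Q -> pi_coherent R.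
Proof.
move=> injQ L S N [n [x hx]].
have [p [_ psurj]] := fg_surj hx.
have [y|s ps] := fg_nonsingular_split injQ psurj; last first.
  exact: split_finitely_presented ps.
(* A scalar annihilates [y] exactly when it annihilates all its coordinates. *)
exists (range (val y)) => a; split=> [ay _ [l _ <-]|h].
  have := congr1 (fun z : N => val z l) ay; rewrite linearZ raddf0; exact.
apply: val_inj; rewrite linearZ raddf0; apply/funext => l.
by apply: h; exists l.
Qed.

Lemma pi_coherent_self_injective : pi_coherent R -> self_injective Q.
Proof.
move=> piR; apply/self_injectiveP => G [G0 GL] Gfun.
have Gfun2 x y y' : G (x, y) -> G (x, y') -> y = y'.
  move=> h h'; have := GL (- 1) _ _ h' h.
  rewrite scaleN1r [_ + _]surjective_pairing /= addNr => /Gfun/eqP.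
  by rewrite addrC subr_eq0 => /eqP.
have Gscale a x y : G (x, y) -> G (a * x, a * y).
  by move=> h; have := GL a _ _ h G0; rewrite addr0.
pose L := {ba : R * R | `[< G (iota ba.1, iota ba.2) >]}.
have GLam (l : L) : G (iota (val l).1, iota (val l).2).
  exact/asboolP/(valP l).
(* Both sides are the value of the homomorphism at the product of the two arguments. *)
have cross (l m : L) : (val l).1 * (val m).2 = (val l).2 * (val m).1.
  apply: TotalQuotient.tofrac_injective; rewrite !rmorphM /=.
  apply: (Gfun2 (iota (val l).1 * iota (val m).1)); first exact: Gscale.
  by rewrite mulrC [_ * iota (val m).1]mulrC; apply: Gscale.
(* Generator [0] is the family of values [a_l] and generator [1] that of arguments [b_l], so column
   [0] of [B] below holds the coefficients of the values. *)
pose gen (i : 'I_2) : L -> R^o :=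
  if i == 0 then (fun l : L => (val l).2) else (fun l : L => (val l).1).
have [N [p [Nfg psurj pE]]] := span_lmod_exists gen.
have {}pE c : p c = 0 <->
    forall l : L, c 0 0 * (val l).2 + c 0 1 * (val l).1 = 0.
  have valp l : val (p c) l = c 0 0 * (val l).2 + c 0 1 * (val l).1.
    rewrite pE big_ord_recl big_ord1 (_ : lift ord0 ord0 = 1) //.
    exact: val_inj.
  split=> [pc l|h]; last first.
    apply: val_inj; rewrite raddf0; apply/funext => l.
    by rewrite valp h.
  by rewrite -valp pc raddf0.
have [k [B hB]] := finitely_presented_kernel (piR _ _ N Nfg) psurj.
have [t ht] := fg_ideal_unit hR (fun i : 'I_k => iota (B i 0)).
set e := \sum_i _ in ht.
have Brel i (l : L) : B i 0 * (val l).2 + B i 1 * (val l).1 = 0.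
  have : p (row i B) = 0 by apply/hB; exists (delta_mx 0 i); rewrite rowE.
  by move=> /pE/(_ l); rewrite !mxE.
have eb (l : L) : e * iota (val l).1 = iota (val l).1.
  (* By [cross] this is a relation, so [b_l] lies in the ideal generated by column [0] of [B]. *)
  have : p (\row_j (if j == 0 then (val l).1 else - (val l).2)) = 0.
    by apply/pE => m; rewrite !mxE /= mulNr cross subrr.
  move=> /hB[u /rowP/(_ 0)]; rewrite !mxE eqxx => ->.
  rewrite rmorph_sum mulr_sumr; apply: eq_bigr => i _.
  by rewrite rmorphM /= mulrCA ht.
(* Both sides are values of the homomorphism at [e * b_l = b_l]. *)
have ea (l : L) : e * iota (val l).2 = iota (val l).2.
  apply: (@Gfun2 (iota (val l).1)) => //.
  by rewrite -{1}eb; apply: Gscale.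
pose q := - \sum_i t i * iota (B i 1).
have qL (l : L) : iota (val l).2 = iota (val l).1 * q.
  rewrite -ea /e /q mulrN mulr_suml mulr_sumr -sumrN; apply: eq_bigr => i _.
  have := congr1 iota (Brel i l); rewrite rmorphD !rmorphM rmorph0 /=.
  move=> /eqP; rewrite addr_eq0 => /eqP h.
  by rewrite -mulrA h mulrN mulrA [iota (val l).1 * _]mulrC.
exists q => y z hyz.
have [b [s [sreg sy]]] := TotalQuotient.tofrac_fraction y.
have [a [s' [sreg' sz]]] := TotalQuotient.tofrac_fraction z.
(* Multiplying [y = b / s] and [z = a / s'] by [s * s'] gives a pair indexed by [L]. *)
have Gl : `[< G (iota (s' * b, s * a).1, iota (s' * b, s * a).2) >].
  apply/asboolP; rewrite /= !rmorphM /= -sy -sz mulrCA.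
  exact: (Gscale _ _ _ (Gscale _ _ _ hyz)).
have := qL (Sub (s' * b, s * a) Gl); rewrite SubK /= !rmorphM /= -sy -sz => h.
apply: (tofrac_lreg (GRing.lregM sreg sreg')); rewrite rmorphM /=.
by rewrite -mulrA h; ring.
Qed.

End Equivalence.

(** * Singly projective modules and the theorem *)

Lemma free_annihilator (R : comPzRingType) (F : lmodType R) (z : F) :
  free_module F ->
  exists X : set R, forall a, a *: z = 0 <-> forall x, X x -> a * x = 0.
Proof.
move=> [I [b [bfree bspan]]]; have [s [c zE]] := bspan z.
(* Independence concerns sequences without repetition, so repeated indices are merged first. *)
have {}zE : z = \sum_(i <- undup s) (c i *+ count_mem i s) *: b i.
  rewrite zE -(big_undup_iterop_count _ s xpredT); apply: eq_bigr => i _.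
  by rewrite -scalerMnl.
exists [set x | exists2 i, i \in undup s & x = c i *+ count_mem i s] => a.
rewrite zE scaler_sumr; split=> [az _ [i si ->]|h].
  apply: (bfree (undup s) (fun i => a * (c i *+ count_mem i s))) => //.
    exact: undup_uniq.
  by rewrite -[RHS]az; apply: eq_bigr => j _; rewrite scalerA.
rewrite big_seq big1 // => i si; rewrite scalerA h ?scale0r //.
by exists i.
Qed.

Lemma free_rV (R : comPzRingType) n : free_module 'rV[R]_n.
Proof.
exists 'I_n, (delta_mx 0); split=> [s c us e i si|v].
  have := congr1 (fun A : 'rV[R]_n => A 0 i) e.
  rewrite summxE (bigD1_seq i) //= !mxE !eqxx mulr1 big1 ?addr0 // => j ji.
  by rewrite !mxE eq_sym (negPf ji) andbF mulr0.
by exists (index_enum 'I_n), (v 0); apply: row_sum_delta.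
Qed.

(** The submodule generated by [y] embeds in a free module, because its inclusion into [M] factors
    through one; there [X] is the set of coordinates. *)
Lemma singly_projective_annihilator (R : comPzRingType) (M : lmodType R)
    (y : M) :
  singly_projective M ->
  exists X : set R, forall a, a *: y = 0 <-> forall x, X x -> a * x = 0.
Proof.
move=> projM.
have [C [p [_ psurj pE]]] := span_lmod_exists (fun _ : 'I_1 => y).
pose z := p (const_mx 1).
have valz : val z = y by rewrite pE big_ord1 mxE scale1r.
have [|F [u [v [Ffree vu]]]] := projM _ C.
  exists z => w; have [c <-] := psurj w; exists (c 0 0).
  rewrite -linearZ; congr (p _); apply/rowP => i.
  by rewrite !mxE mulr1 ord1.
have [X hX] := free_annihilator (u z) Ffree.
exists X => a; rewrite -hX.
have -> : a *: y = val (a *: z) by rewrite linearZ /= valz.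
have -> : a *: u z = u (a *: z) by rewrite linearZ.
split=> [az|e]; last by rewrite -vu e linear0.
by rewrite (_ : a *: z = 0) ?linear0 //; apply: val_inj; rewrite az raddf0.
Qed.

Theorem theorem2p4 (R : comPzRingType) (hR : semihereditary R) :
  (pi_coherent R <-> self_injective (total_quotient_ring R)) /\
  (pi_coherent R ->
   forall M : lmodType R, singly_projective M -> finitely_projective M).
Proof.
split; first split.
- exact: pi_coherent_self_injective.
- exact: self_injective_pi_coherent.
move=> /(pi_coherent_self_injective hR) injQ M projM S N [n [x hx]].
have [p [_ psurj]] := fg_surj hx.
have [y|s ps] := fg_nonsingular_split hR injQ psurj.
  have [X hX] := singly_projective_annihilator (val y) projM.
  exists X => a; rewrite -hX -linearZ.
  split=> [->|e]; first exact: raddf0.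
  by apply: val_inj; rewrite e raddf0.
(* [N] is a direct summand of [R^n], which serves as the free module. *)
exists 'rV[R]_n, s, (val \o p); split; first exact: free_rV.
by move=> y /=; rewrite ps.
Qed.
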